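(* Let $P\subset\mathbb R^d$ be a $d$-dimensional parallelohedron, let $\mathcal T(P)$ be a face-to-face tiling of $\mathbb R^d$ by translates of $P$, and let $F$ be a $(d-k)$-dimensional face of $\mathcal T(P)$. Then $$\nu(F)\leq 2^k,$$ where $\nu(F)=\operatorname{card}\{P'\in\mathcal T(P): F\subset P'\}$ is the valence of $F$.
   Context: A $d$-dimensional parallelohedron is a convex $d$-dimensional polytope $P\subset\mathbb R^d$ that admits a face-to-face tiling $\mathcal T(P)$ of $\mathbb R^d$ by translates (parallel copies) of $P$: the translates cover $\mathbb R^d$, have pairwise disjoint interiors, and any two of them are either disjoint or intersect in a common face of both. A face of the tiling $\mathcal T(P)$ is a non-empty face (of any dimension from $0$ to $d$) of one of its tiles. It is not assumed that the tiling is affinely equivalent to a Voronoi tiling of a lattice. *)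

(* Defs.v *)
From mathcomp Require Export all_boot all_order all_algebra.
From mathcomp Require Export all_classical reals topology normedtype convex.
Set Implicit Arguments.
Unset Strict Implicit.
Unset Printing Implicit Defensive.
Import Order.TTheory GRing.Theory Num.Theory.
Import numFieldNormedType.Exports.
Local Open Scope classical_set_scope.
Local Open Scope ring_scope.

Section Polytopes.
Context (R : realType) (d : nat).
Local Notation V := 'rV[R]_d.
Implicit Types (A B F P : set V) (T : set (set V)).

Definition translate (t : V) A : set V := [set t + x | x in A].

Definition convex_hull A : set V :=
  smallest (fun B => @convex_set R V B) A.

Definition polytope P : Prop :=
  exists2 S : set V, finite_set S & P = convex_hull S.

Definition affine_set A : Prop :=
  forall (x y : V) (t : R), A x -> A y -> A (t *: x + (1 - t) *: y).

Definition affine_hull A : set V := smallest affine_set A.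

(** The empty set has no dimension. *)
Definition has_dim A (m : nat) : Prop :=
  exists (x : V) (U : {vspace V}),
    \dim U = m /\ affine_hull A = translate x [set` U].

(** Intersection with a supporting hyperplane; the zero form makes [P] itself
    and the empty set (improper) faces. *)
Definition face F P : Prop :=
  exists (f : {scalar V}) (b : R),
    (forall x, P x -> f x <= b) /\ F = [set x | P x /\ f x = b].

(** A tiling is the set of its tiles, each tile being a set of points. *)
Definition face_to_face_tiling P T : Prop :=
  [/\ forall A, T A -> exists t, A = translate t P,
      \bigcup_(A in T) A = setT,
      trivIset T (fun A => A°) &
      forall A B, T A -> T B ->
        A `&` B = set0 \/ (face (A `&` B) A /\ face (A `&` B) B)].

Definition parallelohedron P : Prop :=
  [/\ polytope P, has_dim P d & exists T, face_to_face_tiling P T].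

Definition tiling_face T F : Prop :=
  F !=set0 /\ exists2 A, T A & face F A.

(** The valence of [F] is the cardinality of this set. *)
Definition tiles_containing T F : set (set V) :=
  [set A | T A /\ F `<=` A].

End Polytopes.

(* Main.v *)
(** If two tiles [s + P] and [t + P] both contain [F], a linear form separating
    them is constant on [F], and comparing it on a third tile [u + P]
    containing [F] shows that its value at [u] lies between its values at [s]
    and [t], which are distinct.  Modulo the direction of [F], the translation
    vectors thus become a pairwise strictly antipodal set in dimension [k], and
    the theorem of Danzer and Gruenbaum bounds its size by [2 ^ k].  Instead of
    comparing volumes, that theorem is obtained by counting: for [n] antipodal
    points [p i], the [n ^ M] sums [\sum_(m < M) 2 ^ m *: p (w m)] are uniformly
    separated and lie in a box of side [O(2 ^ M)], so [n ^ M = O((2 ^ k) ^ M)]. *)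
Require Import Defs.
From mathcomp Require Import interval_inference ring lra zify.
Set Implicit Arguments.
Unset Strict Implicit.
Unset Printing Implicit Defensive.
Import Order.TTheory GRing.Theory Num.Theory.
Import numFieldNormedType.Exports.
Local Open Scope classical_set_scope.
Local Open Scope ring_scope.
Local Open Scope card_scope.

(** * Linear forms as column vectors *)

Definition pairing (R : pzRingType) (d : nat) (x : 'cV[R]_d) (a : 'rV[R]_d) :
    R :=
  (a *m x) 0 0.

Section Pairing.
Context (R : comPzRingType) (d : nat).
Implicit Types (x y : 'cV[R]_d) (a b : 'rV[R]_d) (c : R).

Lemma pairingD x a b : pairing x (a + b) = pairing x a + pairing x b.
Proof. by rewrite /pairing mulmxDl mxE. Qed.

Lemma pairingB x a b : pairing x (a - b) = pairing x a - pairing x b.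
Proof. by rewrite /pairing mulmxBl !mxE. Qed.

Lemma pairingZ x c a : pairing x (c *: a) = c * pairing x a.
Proof. by rewrite /pairing -scalemxAl mxE. Qed.

Lemma pairingBl x y a : pairing (x - y) a = pairing x a - pairing y a.
Proof. by rewrite /pairing mulmxBr !mxE. Qed.

Lemma pairingZl x c a : pairing (c *: x) a = c * pairing x a.
Proof. by rewrite /pairing -scalemxAr mxE. Qed.

End Pairing.

(** * Theorems of the alternative: Farkas and Stiemke *)

Section Farkas.
Context (R : realFieldType) (d : nat).
Implicit Types (x : 'cV[R]_d) (g : 'rV[R]_d).

(* Bartl's induction: a point violating the conclusion against the first [n]
   forms can be used to project the last form away *)
Lemma farkas_nat (n : nat) (a : nat -> 'rV[R]_d) g :
    (forall x, (forall i, (i < n)%N -> pairing x (a i) <= 0) ->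
      pairing x g <= 0) ->
  exists2 c : nat -> R, (forall i, 0 <= c i) & g = \sum_(i < n) c i *: a i.
Proof.
elim: n a g => [|n IH] a g le0.
  exists (fun=> 0) => //; rewrite big_ord0; apply/rowP => j; rewrite mxE.
  have := le0 (delta_mx j 0) (fun i => ltac:(done)).
  have := le0 (- delta_mx j 0) (fun i => ltac:(done)).
  rewrite -[- _]sub0r pairingBl /pairing mulmx0 -!colE !mxE; lra.
have [le0n|] := pselect (forall x,
    (forall i, (i < n)%N -> pairing x (a i) <= 0) -> pairing x g <= 0).
  have [c c_ge0 ->] := IH a g le0n.
  exists (fun i => if (i < n)%N then c i else 0) => [i|].
    by case: ifP.
  rewrite big_ord_recr /= ltnn scale0r addr0.
  by apply: eq_bigr => i _; rewrite ltn_ord.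
move=> /existsNP[x0] /not_implyP[x0_le /negP]; rewrite -ltNge => x0_gt.
have s_gt0 : 0 < pairing x0 (a n).
  rewrite ltNge; apply/negP => an_le; move: x0_gt; apply/negP; rewrite -leNgt.
  apply: le0 => i; rewrite ltnS leq_eqVlt => /predU1P[->//|]; exact: x0_le.
pose s := pairing x0 (a n).
(* [b] projects along [a n] onto the kernel of [x0]; [bE] gives its adjoint, which maps every [x] to
   a form vanishing on [a n]. *)
pose b (h : 'rV[R]_d) := h - (pairing x0 h / s) *: a n.
have bE x h : pairing x (b h) = pairing (x - (pairing x (a n) / s) *: x0) h.
  rewrite /b pairingB pairingZ pairingBl pairingZl; ring.
have [|c c_ge0 gE] := IH (b \o a) (b g).
  move=> x x_le; rewrite bE; apply: le0 => i.
  rewrite ltnS leq_eqVlt => /predU1P[->|lt_in]; last first.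
    by rewrite -bE; apply: x_le.
  by rewrite pairingBl pairingZl divfK ?subrr // gt_eqF.
(* The coefficient left for [a n] once the projections in [gE] are undone; its sign comes from [x0]
   being positive on [g] and nonpositive on the earlier [a i]. *)
pose e := pairing x0 g / s - \sum_(i < n) c i * (pairing x0 (a i) / s).
have e_ge0 : 0 <= e.
  rewrite subr_ge0; apply: (@le_trans _ _ 0).
    apply: sumr_le0 => i _; rewrite mulr_ge0_le0 // pmulr_lle0 ?invr_gt0 //.
    exact: x0_le.
  by rewrite divr_ge0 // ltW.
exists (fun i => if (i < n)%N then c i else e) => [i|]; first by case: ifP.
rewrite big_ord_recr /= ltnn.
have -> : g = b g + (pairing x0 g / s) *: a n by rewrite subrK.
have -> : e *: a n = (pairing x0 g / s) *: a n -
    \sum_(i < n) (c i * (pairing x0 (a i) / s)) *: a n.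
  by rewrite -scaler_suml -scalerBl.
rewrite gE (addrC (_ *: a n)) addrA; congr (_ + _).
rewrite -sumrN -big_split /=; apply: eq_bigr => i _.
by rewrite ltn_ord scalerBr scalerA.
Qed.

Lemma farkas (I : finType) (a : I -> 'rV[R]_d) g :
    (forall x, (forall i, pairing x (a i) <= 0) -> pairing x g <= 0) ->
  exists2 c : I -> R, (forall i, 0 <= c i) & g = \sum_i c i *: a i.
Proof.
move=> le0.
pose a' m := if (insub m : option 'I_#|I|) is Some j then a (enum_val j) else 0.
have a'E (j : 'I_#|I|) : a' j = a (enum_val j) by rewrite /a' valK.
have [|c c_ge0 ->] := @farkas_nat #|I| a' g.
  move=> x x_le; apply: le0 => i.
  by have := x_le _ (ltn_ord (enum_rank i)); rewrite a'E enum_rankK.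
exists (fun i => c (enum_rank i)) => //.
rewrite (reindex_onto enum_rank enum_val) => [|i _]; last exact: enum_valK.
rewrite (eq_bigl xpredT) => [|i]; last by rewrite enum_rankK eqxx.
by apply: eq_bigr => i _; rewrite a'E enum_rankK.
Qed.

(** If the first alternative fails, Farkas makes every [- a j] a nonnegative combination of the
    [a i]. Adding the relations [a j + (- a j) = 0] over all [j] gives each vector a coefficient of
    at least 1. *)
Lemma stiemke (I : finType) (a : I -> 'rV[R]_d) :
  (exists x, (forall i, 0 <= pairing x (a i)) /\ exists i, 0 < pairing x (a i))
  \/ exists2 c : I -> R, (forall i, 0 < c i) & \sum_i c i *: a i = 0.
Proof.
have [ex|nex] := pselect (exists x,
  (forall i, 0 <= pairing x (a i)) /\ exists i, 0 < pairing x (a i)).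
  by left.
right.
have negE x i : pairing (- x) (a i) = - pairing x (a i).
  by rewrite -scaleN1r pairingZl mulN1r.
have comb j : exists c : I -> R, (forall i, 0 <= c i) /\
    - a j = \sum_i c i *: a i.
  have [|c c_ge0 E] := @farkas I a (- a j); last by exists c.
  move=> x x_le; rewrite -scaleN1r pairingZ mulN1r oppr_le0.
  rewrite leNgt; apply/negP => lt0; apply: nex; exists (- x); split.
    by move=> i; rewrite negE oppr_ge0.
  by exists j; rewrite negE oppr_gt0.
have [c /all_and2[c_ge0 cE]] := choice comb.
exists (fun i => \sum_j (c j i + (i == j)%:R)) => [i|].
  rewrite (bigD1 i) //= eqxx ltr_pwDl //; first by rewrite ltr_wpDl.
  by apply: sumr_ge0 => j _; rewrite addr_ge0.
under eq_bigr do rewrite scaler_suml.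
rewrite exchange_big big1 //= => j _.
under eq_bigr do rewrite scalerDl.
rewrite big_split /= -cE (bigD1 j) //= eqxx scale1r big1 ?addr0 ?addNr //.
by move=> i /negPf->; rewrite scale0r.
Qed.

End Farkas.

(** * Strictly antipodal sets: the bound by counting *)

Lemma expn_growth_le (C n q : nat) :
  (forall M, n ^ M <= C * q ^ M)%N -> (n <= q)%N.
Proof.
move=> grow; rewrite leqNgt; apply/negP => lt_qn.
have C_gt0 : (0 < C)%N by move: (grow 0%N); rewrite !expn0 muln1.
(* At [M = C * q] the right side is at least [(C * q + 1 + q) * q ^ M], which exceeds
   [C * q ^ M.+1]. *)
have bernoulli M : (q ^ M.+1 + M.+1 * q ^ M <= q.+1 ^ M.+1)%N.
  elim: M => [|M IH]; first by rewrite !expn1 !expn0; lia.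
  rewrite [in leqRHS]expnS; apply: leq_trans (leq_mul (leqnn q.+1) IH).
  rewrite !(expnS q); nia.
have [q0|q_gt0] := posnP q.
  by have := grow 1%N; rewrite q0 !expn1 muln0; lia.
have := bernoulli (C * q)%N.
have := grow (C * q).+1.
have : (q.+1 ^ (C * q).+1 <= n ^ (C * q).+1)%N by rewrite leq_exp2r.
have : (0 < q ^ (C * q))%N by rewrite expn_gt0 q_gt0.
rewrite (expnS q); nia.
Qed.

Section Antipodal.
Context (R : realType) (k n : nat) (p : 'I_n -> 'rV[R]_k).

(** Horner form: the head of the word is the lowest digit, so inductions peel off the term of weight
    1. *)
Fixpoint binary_sum (w : seq 'I_n) : 'rV[R]_k :=
  if w is i :: u then p i + 2 *: binary_sum u else 0.

Context (g : 'I_n -> 'I_n -> 'cV[R]_k).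
(** Strict antipodality, normalised: [p i] and [p j] lie on the two boundary hyperplanes of a slab
    of width 1 that contains all the points. *)
Hypothesis g_width : forall i j a b, i != j ->
  `|pairing (g i j) (p b - p a)| <= 1.
Hypothesis g_unit : forall i j, i != j -> pairing (g i j) (p j - p i) = 1.

(** The highest position where the words differ chooses the form. There the gap is exactly 1; each
    lower digit doubles the gap and then costs at most 1, so it never drops below 1. *)
Lemma binary_sum_sep (w w' : seq 'I_n) : size w = size w' -> w != w' ->
  exists i j, i != j /\
    1 <= pairing (g i j) (binary_sum w' - binary_sum w).
Proof.
elim: w w' => [|a u IH] [|b u'] //= [] szE neq.
have diffE (h : 'cV[R]_k) :
    pairing h (p b + 2 *: binary_sum u' - (p a + 2 *: binary_sum u)) =
    pairing h (p b - p a) + 2 * pairing h (binary_sum u' - binary_sum u).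
  by rewrite opprD addrACA -scalerBr pairingD pairingZ.
have [eq_u|neq_u] := eqVneq u u'.
  exists a, b; have neq_ab : a != b.
    by apply: contraNneq neq => ->; rewrite eq_u.
  by rewrite diffE eq_u g_unit // !pairingB !subrr mulr0 addr0.
have [i [j [neq_ij ge1]]] := IH _ szE neq_u.
exists i, j; split=> //; rewrite diffE.
have := g_width a b neq_ij; rewrite ler_norml => /andP[lo _]; lra.
Qed.

Lemma binary_sum_bound (D : R) (w : seq 'I_n) (c : 'I_k) :
  0 <= D -> (forall i, `|p i 0 c| <= D) ->
  `|binary_sum w 0 c| <= D * 2 ^+ size w.
Proof.
move=> D_ge0 pD.
(* The subtracted 1 makes the induction close: [1 + 2 * (2 ^ m - 1) = 2 ^ m.+1 - 1]. *)
suff : `|binary_sum w 0 c| <= D * (2 ^+ size w - 1) by lra.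
elim: w => [|i u IH] /=; first by rewrite mxE normr0 expr0 subrr mulr0.
rewrite !mxE (le_trans (ler_normD _ _)) // normrM ger0_norm // exprS.
have := pD i; nra.
Qed.

Lemma pairing_small (x : 'rV[R]_k) (h : 'cV[R]_k) (G : R) :
  1 + \sum_c `|h c 0| <= G -> (forall c, `|x 0 c| * G < 1) ->
  `|pairing h x| < 1.
Proof.
move=> hG xG; rewrite /pairing mxE.
have sum_ge0 : 0 <= \sum_c `|h c 0| by apply: sumr_ge0.
have G_gt0 : 0 < G by lra.
apply: le_lt_trans (ler_norm_sum _ _ _) _.
rewrite -(ltr_pM2r G_gt0) mul1r.
apply: (@le_lt_trans _ _ (\sum_c `|h c 0|)); last by lra.
rewrite mulr_suml; apply: ler_sum => c _; rewrite normrM.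
by have := xG c; have := normr_ge0 (h c 0); nra.
Qed.

(** Scaled by [G], the sums of distinct words fall into distinct cells of the unit grid, and the box
    holding them has [(K * 2 ^ M) ^ k] cells. *)
Lemma antipodal_growth : exists K : nat, forall M,
  (n ^ M <= (K * 2 ^ M) ^ k)%N.
Proof.
(* [G] exceeds the sum of absolute entries of every form; the leading 1 gives the strict inequality
   and keeps [G] positive even for empty sums. *)
pose G : R := 1 + \sum_i \sum_j \sum_c `|g i j c 0|.
pose D : R := \sum_i \sum_c `|p i 0 c|.
have D_ge0 : 0 <= D by do 2 (apply: sumr_ge0 => ? _).
have pD i c : `|p i 0 c| <= D.
  rewrite /D (bigD1 i) //= (bigD1 c) //= -!addrA lerDl.
  by rewrite addr_ge0 //; apply: sumr_ge0 => // ? _; apply: sumr_ge0.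
have gG i j : 1 + \sum_c `|g i j c 0| <= G.
  rewrite lerD2l (bigD1 i) //= (bigD1 j) //= -addrA lerDl.
  by rewrite addr_ge0 //; do ?(apply: sumr_ge0 => * ).
have G_gt0 : 0 < G.
  by rewrite ltr_pwDl //; do 3 (apply: sumr_ge0 => ? _).
(* The shifted and scaled coordinates [y] below range over [[0, 2 * D * G * 2 ^ M]]. *)
pose K := (Num.truncn (2 * D * G)).+1.
exists K => M.
pose y (w : M.-tuple 'I_n) c : R := (binary_sum w 0 c + D * 2 ^+ M) * G.
have bound (w : M.-tuple 'I_n) c : `|binary_sum w 0 c| <= D * 2 ^+ M.
  by have := binary_sum_bound w D_ge0 (fun i => pD i c); rewrite size_tuple.
have y_ge0 w c : 0 <= y w c.
  rewrite mulr_ge0 ?(ltW G_gt0) //.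
  by have := bound w c; rewrite ler_norml => /andP[]; lra.
have y_lt w c : (Num.truncn (y w c) < K * 2 ^ M)%N.
  rewrite truncn_lt_nat ?y_ge0//.
  have KG : 2 * D * G < K%:R by apply: truncnS_gt.
  apply: (@le_lt_trans _ _ (2 * D * G * 2 ^+ M)).
    rewrite /y [leRHS]mulrAC ler_pM2r //.
    by have := bound w c; rewrite ler_norml => /andP[]; lra.
  by rewrite natrM natrX ltr_pM2r // exprn_gt0.
pose cell (w : M.-tuple 'I_n) : {ffun 'I_k -> 'I_(K * 2 ^ M)} :=
  [ffun c => Ordinal (y_lt w c)].
suff cell_inj : injective cell.
  by have := leq_card _ cell_inj; rewrite card_tuple card_ffun !card_ord.
(* In a common cell the coordinates differ by less than [1 / G], so every form separates the two
   sums by less than 1, against [binary_sum_sep]. *)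
move=> w w' /ffunP eq_cell; apply/eqP/negPn/negP => neq.
have [|i [j [neq_ij]]] := @binary_sum_sep w w' _ neq.
  by rewrite !size_tuple.
apply/negP; rewrite -ltNge; apply: le_lt_trans (ler_norm _) _.
apply: pairing_small (gG i j) _ => c.
have := congr1 val (eq_cell c); rewrite !ffunE /= => eq_t.
have := truncn_itv (y_ge0 w c); have := truncn_itv (y_ge0 w' c).
rewrite eq_t => /andP[l1 u1] /andP[l2 u2].
rewrite -[X in _ * X](gtr0_norm G_gt0) -normrM !mxE ltr_norml.
move: l1 u1 l2 u2; rewrite /y -natr1; lra.
Qed.

Lemma antipodal_bound : (n <= 2 ^ k)%N.
Proof.
have [K growth] := antipodal_growth.
apply: (@expn_growth_le (K ^ k)) => M.
by rewrite -expnM (mulnC k) expnM -expnMn.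
Qed.

End Antipodal.

(** * Convex and affine hulls, interiors, separation of translates *)

Section Hulls.
Context (R : realType) (d : nat).
Local Notation V := 'rV[R]_d.
Implicit Types (x : 'cV[R]_d) (A B S P F : set V).

Lemma convex_segment B (u v : V) (r : R) : @convex_set R V B ->
  B u -> B v -> 0 <= r -> r <= 1 -> B (r *: u + (1 - r) *: v).
Proof.
move=> convB Bu Bv r0 r1.
by have := convB u v (Itv01 r0 r1); rewrite !inE; apply.
Qed.

Lemma convex_comb B n (v : 'I_n -> V) (c : 'I_n -> R) :
  @convex_set R V B -> (forall i, B (v i)) -> (forall i, 0 < c i) ->
  \sum_i c i = 1 -> B (\sum_i c i *: v i).
Proof.
move=> convB Bv c_gt0 sum1.
(* Partial sums are renormalised to total weight 1, so that each new point enters through one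
   segment. *)
suff H (r : seq 'I_n) : r != [::] ->
    0 < \sum_(i <- r) c i /\
    B ((\sum_(i <- r) c i)^-1 *: \sum_(i <- r) c i *: v i).
  have [|_] := H (index_enum 'I_n).
    case: index_enum sum1 => //; rewrite big_nil => /esym/eqP.
    by rewrite oner_eq0.
  by rewrite sum1 invr1 scale1r.
elim: r => // i r IH _; rewrite !big_cons.
have [->|/IH[s_gt0 Bs]] := eqVneq r [::].
  rewrite !big_nil !addr0 scalerA mulVf ?gt_eqF //; split => //.
  by rewrite scale1r.
set s := \sum_(j <- r) c j in s_gt0 Bs *.
have t_gt0 : 0 < c i + s by rewrite addr_gt0.
split=> //.
have := @convex_segment B _ _ (c i / (c i + s)) convB (Bv i) Bs.
have -> : 1 - c i / (c i + s) = s / (c i + s) by field; rewrite gt_eqF.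
rewrite scalerA mulrAC divff ?gt_eqF // mul1r mulrC -scalerA -scalerDr; apply.
  by rewrite mulr_ge0 ?invr_ge0 ?ltW.
by rewrite ler_pdivrMl // mulr1 lerDl ltW.
Qed.

Lemma convex_hull_comb S n (v : 'I_n -> V) (c : 'I_n -> R) :
  (forall i, S (v i)) -> (forall i, 0 < c i) -> \sum_i c i = 1 ->
  convex_hull S (\sum_i c i *: v i).
Proof.
by move=> Sv c_gt0 sum1 B [convB SB]; apply: convex_comb => // i; apply: SB.
Qed.

Lemma convex_hull_halfspace S x (b : R) :
  (forall y, S y -> pairing x y <= b) ->
  forall y, convex_hull S y -> pairing x y <= b.
Proof.
move=> Sb y /(_ [set w | pairing x w <= b]); apply; split=> // u v l.
rewrite !inE /= => ub vb.
rewrite pairingD !pairingZ.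
have : 0 <= l%:inum by [].
have : l%:inum <= 1 by [].
rewrite /unstable.onem; nra.
Qed.

Lemma affine_hull_level A x (c : R) :
  (forall y, A y -> pairing x y = c) ->
  forall y, affine_hull A y -> pairing x y = c.
Proof.
move=> Ac y /(_ [set w | pairing x w = c]); apply; split=> // u v r /= uc vc.
by rewrite pairingD !pairingZ uc vc; ring.
Qed.

Lemma pairing_eq0 x : (forall y, pairing x y = 0) -> x = 0.
Proof.
move=> x0; apply/colP => i; have := x0 (delta_mx 0 i).
by rewrite /pairing -rowE !mxE.
Qed.

(** The empty set is affine, hence its own affine hull, whereas a translated subspace contains its
    base point. *)
Lemma has_dim_nonempty A m : has_dim A m -> A !=set0.
Proof.
move=> [p [U [_ hullA]]]; apply: contrapT => /set0P/negP/negPn/eqP A0.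
have : affine_hull A p.
  by rewrite hullA; exists 0; rewrite ?addr0 //; exact: mem0v.
by rewrite A0 => /(_ set0); apply; split=> // u v r [].
Qed.

Lemma full_dim_pairing P x : has_dim P d ->
  (forall a b, P a -> P b -> pairing x a = pairing x b) -> x = 0.
Proof.
move=> [p [U [dimU hullP]]] const.
have UT : U = fullv.
  by apply/eqP; rewrite eqEdim subvf dimvf /dim /= dimU mul1n leqnn.
have [a Pa] : P !=set0 by apply: (@has_dim_nonempty _ d); exists p, U.
have allc y : pairing x y = pairing x a.
  apply: (affine_hull_level (A := P)) => [b Pb|]; first exact: const.
  rewrite hullP UT.
  by exists (y - p); [exact: memvf | rewrite addrC subrK].
apply: pairing_eq0 => y; rewrite allc -(allc 0).
by rewrite -(subrr y) pairingB subrr.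
Qed.

Lemma pairing_continuous x : continuous (pairing x).
Proof.
rewrite (_ : pairing x = fun w : V => \sum_j w 0 j * x j 0); last first.
  by apply/funext => w; rewrite /pairing mxE.
elim: (index_enum _) => [|j r IH] y.
  under eq_fun do rewrite big_nil. exact: cst_continuous.
under eq_fun do rewrite big_cons.
apply: cvgD (IH y); apply: cvgM; last exact: cvg_cst.
exact: coord_continuous.
Qed.

(** A point with positive barycentric weights on an affinely spanning family is interior: a small
    displacement [w] is absorbed by a linear, hence small, change of the weights. *)
Lemma convex_hull_near S n (v : 'I_n -> V) (m : 'I_n -> R) :
  (forall x, (forall i j, pairing x (v i) = pairing x (v j)) -> x = 0) ->
  (forall i, S (v i)) -> (forall i, 0 < m i) -> \sum_i m i = 1 ->
  \forall w \near (0 : V), convex_hull S (\sum_i m i *: v i + w).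
Proof.
move=> full Sv m_gt0 sum1; set z := \sum_i m i *: v i.
pose M : 'M_(n, d) := \matrix_i (v i - z).
have full_M : row_full M.
  (* A column of the cokernel is a form constant on the [v i], so it vanishes; thus the [v i - z]
     span the space. *)
  rewrite -cokermx_eq0; apply/eqP/matrixP => i0 j; rewrite [RHS]mxE.
  have x0 i : pairing (col j (cokermx M)) (v i - z) = 0.
    rewrite /pairing -(rowK (fun i => v i - z) i) -/M -!row_mul colE mulmxA.
    by rewrite mulmx_coker mul0mx !mxE.
  have /colP/(_ i0) : col j (cokermx M) = 0.
    apply: full => a b; have := x0 a; have := x0 b; rewrite !pairingB; lra.
  by rewrite !mxE.
pose N := pinvmx M.
(* [w *m N] expresses [w] through the [v i - z]. Expanding [z] over the [v i] yields the
   coefficients [h i], whose sum is 0, so the total weight stays 1. *)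
pose h i : 'cV[R]_d := col i N - m i *: \sum_j col j N.
have hE i w : pairing (h i) w = (w *m N) 0 i - m i * \sum_j (w *m N) 0 j.
  rewrite /h pairingBl pairingZl; congr (_ - _ * _).
    by rewrite /pairing colE mulmxA -colE mxE.
  rewrite /pairing mulmx_sumr summxE; apply: eq_bigr => j _.
  by rewrite colE mulmxA -colE mxE.
have near_gt i : \forall w \near (0 : V), - m i < pairing (h i) w.
  have cont : pairing (h i) w @[w --> (0 : V)] --> pairing (h i) 0.
    exact: pairing_continuous.
  apply: (cvgr_gt _ cont).
  by rewrite /pairing mul0mx mxE oppr_lt0.
have : \forall w \near (0 : V), forall i, - m i < pairing (h i) w.
  exact: (@filter_forall _ _ (fun i (w : V) => - m i < pairing (h i) w)
    (nbhs (0 : V)) _ near_gt).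
apply: filterS => w w_gt.
have -> : z + w = \sum_i (m i + pairing (h i) w) *: v i.
  under [RHS]eq_bigr do rewrite scalerDl.
  rewrite big_split /= -/z; congr (_ + _).
  under eq_bigr do rewrite hE scalerBl; rewrite sumrB.
  under [X in _ - X]eq_bigr do rewrite mulrC -scalerA.
  rewrite -scaler_sumr -/z scaler_suml -sumrB.
  under eq_bigr do rewrite -scalerBr.
  have {1}-> : w = (w *m N) *m M by rewrite -mulmxA mulVpmx // mulmx1.
  rewrite [LHS]mulmx_sum_row; apply: eq_bigr => i _.
  by rewrite rowK.
apply: convex_hull_comb => // [i|]; first by have := w_gt i; lra.
rewrite big_split /= sum1; under eq_bigr do rewrite hE.
by rewrite sumrB -mulr_suml sum1 mul1r subrr addr0.
Qed.

Lemma interior_translate P (t z : V) :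
  (\forall w \near (0 : V), P (z - t + w)) -> (translate t P)° z.
Proof.
move=> Pz; have : \forall w \near (0 : V), translate t P (z + w).
  move: Pz; apply: filterS => w Pw.
  by exists (z - t + w) => //; rewrite addrA addrCA subrr addr0.
by move/(nbhs0P (translate t P) z).
Qed.

(** Stiemke is applied to the differences of generators of the two translates. A form gives the
    separation; a positive relation gives a point interior to both. *)
Lemma separate_translates P (s t : V) : polytope P -> has_dim P d ->
  ~ ((translate s P)° `&` (translate t P)° !=set0) ->
  exists x, (forall a b, P a -> P b -> pairing x (s + a) <= pairing x (t + b))
    /\ exists a b, [/\ P a, P b & pairing x (s + a) < pairing x (t + b)].
Proof.
move=> [S /finite_seqP[r ->] PE] dimP disj.
pose v (i : 'I_(size r)) : V := r`_i.
have Sv i : [set` r] (v i) by apply: mem_nth.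
have Pv i : P (v i) by rewrite PE => B [_]; apply; apply: Sv.
have vS y : [set` r] y -> exists i, y = v i.
  move=> /= ry; have lt : (index y r < size r)%N by rewrite index_mem.
  by exists (Ordinal lt); rewrite /v /= nth_index.
have [i0 _] : exists i : 'I_(size r), True.
  apply: contrapT => none; have [a] := has_dim_nonempty dimP.
  rewrite PE => /(_ set0); apply; split; first by move=> ? ? ?; rewrite inE.
  by move=> y /vS[i]; case: none; exists i.
have full x : (forall i j, pairing x (v i) = pairing x (v j)) -> x = 0.
  move=> const; apply: (full_dim_pairing dimP).
  have le a i : P a -> pairing x a <= pairing x (v i).
    rewrite PE; apply: convex_hull_halfspace => y /vS[j ->].
    by rewrite (const j i).
  have ge a i : P a -> pairing x (v i) <= pairing x a.
    move=> Pa; suff : pairing (- 1 *: x) a <= - pairing x (v i).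
      by rewrite pairingZl; lra.
    move: Pa; rewrite PE; apply: convex_hull_halfspace => y /vS[j ->].
    by rewrite pairingZl (const j i) mulN1r.
  move=> a b Pa Pb; apply/eqP.
  by rewrite eq_le !(le_trans (le _ i0 _) (ge _ i0 _)).
pose e (ij : 'I_(size r) * 'I_(size r)) : V := (t + v ij.2) - (s + v ij.1).
have [[x [x_ge0 [[i j] x_gt0]]]|[c c_gt0 c0]] := stiemke e.
  have sep i' j' : pairing x (s + v i') <= pairing x (t + v j').
    by have := x_ge0 (i', j'); rewrite pairingB subr_ge0.
  exists x; split; last first.
    by exists (v i), (v j); split => //; rewrite -subr_gt0 -pairingB.
  move=> a b Pa Pb.
  have le1 j' : pairing x (s + a) <= pairing x (t + v j').
    rewrite pairingD -lerBrDl; move: Pa; rewrite PE.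
    apply: convex_hull_halfspace => y /vS[i' ->].
    by rewrite lerBrDl -pairingD.
  suff : pairing (- 1 *: x) b <= pairing x t - pairing x (s + a).
    by rewrite pairingZl [pairing x (t + b)]pairingD; lra.
  move: Pb; rewrite PE; apply: convex_hull_halfspace => y /vS[j' ->].
  by have := le1 j'; rewrite pairingZl [pairing x (t + _)]pairingD; lra.
exfalso; apply: disj.
have C_gt0 : 0 < \sum_ij c ij.
  rewrite (bigD1 (i0, i0)) //= ltr_pwDl //; apply: sumr_ge0 => ij _.
  exact: ltW.
set C := \sum_ij c ij in C_gt0.
pose m i j := c (i, j) / C.
have m_gt0 i j : 0 < m i j by rewrite divr_gt0.
have sum1 : \sum_i \sum_j m i j = 1.
  rewrite pair_bigA -mulr_suml -/C.
  under eq_bigr do rewrite -surjective_pairing.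
  by rewrite divff ?gt_eqF.
have sum_gt0 (f : 'I_(size r) -> R) : (forall i, 0 < f i) -> 0 < \sum_i f i.
  move=> f_gt0; rewrite (bigD1 i0) //= ltr_pwDl //.
  by apply: sumr_ge0 => i _; apply: ltW.
(* The two marginals of [m] are positive weights on the generators, and the relation says that they
   represent the same point in both translates. *)
pose z := s + \sum_i (\sum_j m i j) *: v i.
have zE : z = t + \sum_j (\sum_i m i j) *: v j.
  have sum0 : \sum_i \sum_j m i j *: e (i, j) = 0.
    transitivity (C^-1 *: \sum_ij c ij *: e ij); last by rewrite c0 scaler0.
    rewrite pair_bigA scaler_sumr.
    by apply: eq_bigr => -[i j] _; rewrite scalerA mulrC.
  apply/esym/eqP; rewrite -subr_eq0 /z opprD addrACA; apply/eqP.
  rewrite -[RHS]sum0 -[t - s]scale1r -sum1 scaler_suml.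
  under [X in _ + (X - _)]eq_bigr do rewrite scaler_suml.
  rewrite exchange_big -sumrB -big_split /=; apply: eq_bigr => i _.
  rewrite !scaler_suml -sumrB -big_split /=; apply: eq_bigr => j _.
  by rewrite -scalerBr -scalerDr /e /= opprD addrACA.
exists z; split; apply: interior_translate.
  rewrite /z addrAC subrr add0r PE.
  by apply: convex_hull_near => // i; apply: sum_gt0.
rewrite zE addrAC subrr add0r PE.
apply: convex_hull_near => // [i|]; first exact: sum_gt0.
by rewrite exchange_big.
Qed.

End Hulls.

(** * From tiles around a face to antipodal points *)

Section Valence.
Context (R : realType) (d : nat).
Local Notation V := 'rV[R]_d.
Implicit Types (x : 'cV[R]_d) (P F : set V) (T : set (set V)).

(** A form constant on [F] annihilates the direction [U] of its affine hull. The columns of [N] are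
    a basis of the annihilator of [U], so [y *m N] is [y] modulo [U] and such forms factor through
    this quotient. *)
Lemma level_factor F m : has_dim F m ->
  exists N : 'M[R]_(d, d - m), forall x c,
    (forall y, F y -> pairing x y = c) -> exists h, x = N *m h.
Proof.
move=> [p [U [dimU hullF]]].
pose M : 'M[R]_(\dim U, d) := \matrix_i (vbasis U)`_i.
have free_M : row_free M.
  rewrite -kermx_eq0; apply/eqP/row_matrixP => i; rewrite row0.
  have : row i (kermx M) *m M = 0 by rewrite -row_mul mulmx_ker row0.
  rewrite mulmx_sum_row => sum0; apply/rowP => j; rewrite [RHS]mxE.
  have /freeP/(_ (fun l => row i (kermx M) 0 l)) := basis_free (vbasisP U).
  apply; rewrite -[RHS]sum0; apply: eq_bigr => l _; by rewrite rowK.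
have rankK : \rank (kermx M^T) = (d - m)%N.
  by rewrite mxrank_ker mxrank_tr (eqP free_M) dimU.
exists (castmx (erefl _, rankK) (row_base (kermx M^T))^T) => x c Fc.
have Mx0 : M *m x = 0.
  apply/row_matrixP => i; rewrite row0 row_mul rowK.
  have hull u : u \in U -> pairing x (p + u) = c.
    by move=> Uu; apply: (affine_hull_level Fc); rewrite hullF; exists u.
  apply/rowP => j; rewrite ord1 [RHS]mxE.
  have := hull _ (vbasis_mem (mem_nth 0 (_ : (i < size (vbasis U))%N))).
  rewrite size_tuple ltn_ord => /(_ isT); have := hull _ (mem0v U).
  by rewrite addr0 pairingD => ->; rewrite /pairing; lra.
have : (x^T <= row_base (kermx M^T))%MS.
  by rewrite eq_row_base; apply/sub_kermxP; rewrite -trmx_mul Mx0 trmx0.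
case/submxP => h xE; exists (castmx (rankK, erefl _) h^T).
rewrite -[x]trmxK xE trmx_mul; move: h xE (row_base _).
by case: _ / rankK => h _ N; rewrite !castmx_id.
Qed.

Lemma translates_card P F n m (t : 'I_n -> V) : polytope P -> has_dim P d ->
  has_dim F m -> (forall i, F `<=` translate (t i) P) ->
  (forall i j, i != j ->
    ~ ((translate (t i) P)° `&` (translate (t j) P)° !=set0)) ->
  (n <= 2 ^ (d - m))%N.
Proof.
move=> polyP dimP dimF FP disj.
have [f Ff] := has_dim_nonempty dimF.
have [N NP] := level_factor dimF.
(* The condition [i != j] sits under the existential so that [choice] applies to all pairs; the
   diagonal gets the zero form. *)
have sep i j : exists h : 'cV[R]_(d - m), i != j ->
    [/\ forall l, pairing h (t i *m N) <= pairing h (t l *m N),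
        forall l, pairing h (t l *m N) <= pairing h (t j *m N) &
        pairing h (t i *m N) < pairing h (t j *m N)].
  have [->|neq] := eqVneq i j; first by exists 0.
  have [x [x_le [a0 [b0 [Pa0 Pb0 lt0]]]]] :=
    separate_translates polyP dimP (disj i j neq).
  have Fconst y : F y -> pairing x y = pairing x f.
    (* Any point of [F] may be viewed in either tile, so the separation applies in both orders. *)
    have Fle u v : F u -> F v -> pairing x u <= pairing x v.
      by move=> /(FP i)[a Pa <-] /(FP j)[b Pb <-]; apply: x_le.
    by move=> Fy; apply/eqP; rewrite eq_le !Fle.
  have [h xE] := NP x _ Fconst.
  have hE y : pairing h (y *m N) = pairing x y.
    by rewrite xE /pairing mulmxA.
  exists h => _; have le_f a : P a -> pairing x (t i + a) <= pairing x f.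
    by move=> Pa; have [b Pb <-] := FP j f Ff; apply: x_le.
  have ge_f b : P b -> pairing x f <= pairing x (t j + b).
    by move=> Pb; have [a Pa <-] := FP i f Ff; apply: x_le.
  have le_i l : pairing x (t i) <= pairing x (t l).
    have [a Pa fE] := FP l f Ff.
    by have := le_f a Pa; rewrite -fE !pairingD; lra.
  have le_j l : pairing x (t l) <= pairing x (t j).
    have [a Pa fE] := FP l f Ff.
    by have := ge_f a Pa; rewrite -fE !pairingD; lra.
  split=> [l|l|]; rewrite !hE //.
  (* Adding the strict inequality at [(a0, b0)] to the weak one at [(b0, a0)] cancels both points
     and leaves a strict one between [t i] and [t j]. *)
  have := x_le b0 a0 Pb0 Pa0; move: lt0; rewrite !pairingD; have := le_i j; lra.
have {}sep ij := sep ij.1 ij.2.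
have [h hP] := choice sep.
pose w i j := pairing (h (i, j)) (t j *m N) - pairing (h (i, j)) (t i *m N).
apply: (@antipodal_bound _ _ _ (fun i => t i *m N)
  (fun i j => (w i j)^-1 *: h (i, j))) => [i j a b neq|i j neq].
  have [/= le_i le_j lt] := hP (i, j) neq.
  rewrite pairingZl pairingB.
  have w_gt0 : 0 < w i j by rewrite subr_gt0.
  rewrite normrM gtr0_norm ?invr_gt0 // ler_pdivrMl // mulr1 ler_norml /w.
  have := (le_i a, le_i b, le_j a, le_j b).
  by move=> [[[]]]; lra.
have [/= _ _ lt] := hP (i, j) neq.
by rewrite pairingZl pairingB mulVf // subr_eq0 gt_eqF.
Qed.

End Valence.

Theorem theorem2 (R : realType) (d k : nat) (P : set 'rV[R]_d)
    (T : set (set 'rV[R]_d)) (F : set 'rV[R]_d) :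
  parallelohedron P ->
  face_to_face_tiling P T ->
  tiling_face T F ->
  (k <= d)%N ->
  has_dim F (d - k) ->
  tiles_containing T F #<= `I_(2 ^ k).
Proof.
move=> [polyP dimP _] [tileP _ disjT _] _ le_kd dimF.
have bound (s : seq (set 'rV[R]_d)) : uniq s ->
    [set` s] `<=` tiles_containing T F -> (size s <= 2 ^ k)%N.
  (* With [m = d - k], the codimension [d - m] is [k] again. *)
  move=> uniq_s sT; rewrite -(subKn le_kd).
  pose A (i : 'I_(size s)) := nth set0 s i.
  have AT i : tiles_containing T F (A i) by apply: sT; apply: mem_nth.
  have /choice[t tP] i : exists t, A i = translate t P.
    by have [TA _] := AT i; apply: tileP.
  apply: (translates_card (t := t) polyP dimP dimF) => [i|i j neq].
    by rewrite -tP; have [] := AT i.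
  rewrite -!tP; apply: contra_not (negP neq) => /disjT -/(_ (AT i).1 (AT j).1).
  by move/eqP; rewrite nth_uniq.
have [/finite_setP[n cardT]|/infinite_set_fset] :=
    pselect (finite_set (tiles_containing T F)); last first.
  (* An infinite family would contain [2 ^ k + 1] distinct tiles, already too many. *)
  move=> /(_ (2 ^ k).+1)[B BT]; have := bound _ (finmap.fset_uniq B) BT.
  by move=> le /(leq_trans _) - /(_ _ (leqnn _)); rewrite ltnNge le.
rewrite (card_le_eql cardT) card_le_II -(card_fset_set cardT).
apply: bound (finmap.fset_uniq _) _; rewrite fset_setK //.
by apply/finite_setP; exists n.
Qed.
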